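(* Let $n\ge 1$ be an integer and let $t_1,\dots,t_n\in\mathbb{R}$ satisfy $|t_i|>2$ for all $1\le i\le n$. Then $$\left|\operatorname{tr}\left(\prod_{i=1}^n \begin{bmatrix} 0 & -1 \\ 1 & t_i\end{bmatrix}\right)\right|>2.$$
   Context: The product of matrices is ordered: $\prod_{i=1}^n T_i = T_1T_2\cdots T_n$. Here $\operatorname{tr}$ denotes the trace of a real $2\times 2$ matrix. *)

(* Defs.v *)
From HB Require Import structures.
From mathcomp Require Import all_boot all_order all_algebra.
From mathcomp Require Import reals.

Set Implicit Arguments.
Unset Strict Implicit.
Unset Printing Implicit Defensive.

Import Order.TTheory GRing.Theory Num.Theory.

Local Open Scope ring_scope.

Definition tmx (R : realType) (x : R) : 'M[R]_2 :=
  \matrix_(i < 2, j < 2)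
    nth 0 (nth [::] [:: [:: 0; -1];
                        [:: 1;  x]] i) j.

(* Main.v *)
Require Import Defs.
From HB Require Import structures.
From mathcomp Require Import all_boot all_order all_algebra.
From mathcomp Require Import reals lra.

Set Implicit Arguments.
Unset Strict Implicit.
Unset Printing Implicit Defensive.

Import Order.TTheory GRing.Theory Num.Theory.

Local Open Scope ring_scope.

(** Write the product as [[a, b], [c, d]].  Multiplying by one more factor on
    the right turns the first row (a, b) into (b, t b - a), and
    |t b - a| - |b| >= |b| - |a|, so |b| - |a| >= 1 for every nonempty product.
    Multiplying on the left turns the second column (b, d) into (- d, b + t d),
    and in the same way |d| - |b| > 1.  Hence |a + d| >= |d| - |a| > 2. *)

(** By the reverse triangle inequality, [|t * y - x|] is at least [|t| |y| - |x|], hence at least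
    [2 |y| - |x|]. *)
Lemma norm_recurrence_gap (R : realDomainType) (t x y : R) :
  2 <= `|t| -> `|y| - `|x| <= `|t * y - x| - `|y|.
Proof.
move=> ht; have := lerB_dist (t * y) x; rewrite normrM.
have := ler_wpM2r (normr_ge0 y) ht; lra.
Qed.

Lemma sum_ord2 (V : nmodType) (F : 'I_2 -> V) : \sum_(i < 2) F i = F 0 + F 1.
Proof.
rewrite big_ord_recr big_ord1.
by congr (F _ + F _); apply: val_inj.
Qed.

Lemma mul_tmx_row (R : realType) (A : 'M[R]_2) (x : R) (i : 'I_2) :
  (A *m tmx x) i 0 = A i 1 /\ (A *m tmx x) i 1 = x * A i 1 - A i 0.
Proof.
by rewrite !mxE !sum_ord2 !mxE /= mulr0 mulr1 add0r mulrN1 addrC mulrC.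
Qed.

Lemma tmx_mul_col (R : realType) (A : 'M[R]_2) (x : R) (j : 'I_2) :
  (tmx x *m A) 0 j = - A 1 j /\ (tmx x *m A) 1 j = A 0 j + x * A 1 j.
Proof.
by rewrite !mxE !sum_ord2 !mxE /= mul0r mul1r add0r mulN1r.
Qed.

Lemma prod_tmx_row_gap (R : realType) (n : nat) (t : 'I_n -> R) :
  (forall i, 2 <= `|t i|) ->
  let P := \prod_(i < n) tmx (t i) in (0 < n)%N -> 1 <= `|P 0 1| - `|P 0 0|.
Proof.
elim: n t => // n IHn t ht /= _; rewrite big_ord_recr /=.
have [-> ->] := mul_tmx_row (\prod_(i < n) tmx (t (widen_ord (leqnSn n) i)))
  (t ord_max) 0.
(* The empty product has first row (1, 0), with gap -1, so the induction starts at one factor: row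
   (0, -1), gap exactly 1. *)
case: n => [|n] in t ht IHn *.
  by rewrite big_ord0 !mxE /= mulr0 sub0r normrN normr1 normr0 subr0.
apply: le_trans (norm_recurrence_gap _ _ (ht ord_max)).
exact: (IHn (fun i => t (widen_ord (leqnSn _) i)) (fun i => ht _)).
Qed.

Lemma prod_tmx_col_gap (R : realType) (n : nat) (t : 'I_n -> R) :
  (forall i, 2 < `|t i|) ->
  let P := \prod_(i < n) tmx (t i) in (0 < n)%N -> 1 < `|P 1 1| - `|P 0 1|.
Proof.
elim: n t => // n IHn t ht /= _; rewrite big_ord_recl /=.
have [-> ->] := tmx_mul_col (\prod_(i < n) tmx (t (lift ord0 i))) (t ord0) 1.
(* One factor has second column (-1, t), with gap |t| - 1; the strict bound originates here. *)
case: n => [|n] in t ht IHn *.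
  rewrite big_ord0 !mxE /= mulr1 add0r normrN normr1.
  by have := ht ord0; lra.
set P := \prod_(i < _) _.
(* The sign turns [t * y - x] into the new lower entry. *)
have := norm_recurrence_gap (- P 0 1) (P 1 1) (ltW (ht ord0)).
rewrite opprK (addrC (_ * _)) !normrN; apply: lt_le_trans.
exact: (IHn (fun i => t (lift ord0 i)) (fun i => ht _)).
Qed.

Theorem theorem3p1 (R : realType) (n : nat) (hn : (1 <= n)%N) (t : 'I_n -> R)
  (ht : forall i : 'I_n, 2 < `|t i|) :
  2 < `| \tr (\prod_(i < n) tmx (t i)) |.
Proof.
have := prod_tmx_row_gap (fun i => ltW (ht i)) hn.
have := prod_tmx_col_gap ht hn.
set P := \prod_(i < n) _ => hcol hrow.
(* As a difference, the trace is bounded below by [|P 1 1| - |P 0 0|], the sum of the two gaps. *)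
have -> : \tr P = P 1 1 - - P 0 0.
  by rewrite /mxtrace sum_ord2 opprK addrC.
by have := lerB_dist (P 1 1) (- P 0 0); rewrite normrN; lra.
Qed.
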